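(* Let $q$ be a prime power and $n\ge 4$. In $\mathrm{PG}(n-1,q^n)$ let $\Gamma$ be a subspace of dimension $n-3$, $\Lambda$ a line, and $\Sigma\cong\mathrm{PG}(n-1,q)$ a canonical subgeometry, such that $\Gamma\cap\Sigma=\emptyset=\Gamma\cap\Lambda$. Assume that $L=p_{\Gamma,\Lambda}(\Sigma)$ is a scattered linear set of $\Lambda$. If $\mathrm{intn}_{\sigma}(\Gamma)=2$ for some generator $\sigma$ of the subgroup of $\mathrm{P}\Gamma\mathrm{L}(n,q^n)$ fixing $\Sigma$ pointwise, then there exists a unique point $P$ such that \[\Gamma=\langle P,P^{\sigma},\ldots,P^{\sigma^{n-4}},Q\rangle\] for some point $Q$. Furthermore, if the line $\langle P^{\sigma^{n-1}},P^{\sigma^{n-3}}\rangle$ meets $\Gamma$, then $L$ is of LP-type.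
   Context: A canonical subgeometry of $\mathrm{PG}(n-1,q^n)=\mathrm{PG}(V,\mathbb{F}_{q^n})$ is a set $\{\langle u\rangle_{\mathbb{F}_{q^n}}: u\in S\setminus\{0\}\}$ where $S$ is an $n$-dimensional $\mathbb{F}_q$-subspace of $V$ spanning $V$ over $\mathbb{F}_{q^n}$. The subgroup of $\mathrm{P}\Gamma\mathrm{L}(n,q^n)$ fixing $\Sigma$ pointwise is cyclic of order $n$. The projection is $p_{\Gamma,\Lambda}(\Sigma)=\{\langle\Gamma,X\rangle\cap\Lambda : X\in\Sigma\}$. For a subspace $\Gamma$ of (projective) dimension $k$, $\mathrm{intn}_\sigma(\Gamma)$ is the least positive integer $r$ with $\dim(\Gamma\cap\Gamma^{\sigma}\cap\cdots\cap\Gamma^{\sigma^r})>k-2r$ (empty subspace has dimension $-1$). For a $2$-dimensional $\mathbb{F}_{q^n}$-space $W$, an $\mathbb{F}_q$-linear set of $\mathrm{PG}(W,\mathbb{F}_{q^n})=\mathrm{PG}(1,q^n)$ of rank $\rho$ is $L_U=\{\langle u\rangle_{\mathbb{F}_{q^n}}: u\in U\setminus\{0\}\}$ for a $\rho$-dimensional $\mathbb{F}_q$-subspace $U$ of $W$; the weight of a point $\langle u\rangle$ is $\dim_{\mathbb{F}_q}(U\cap\langle u\rangle_{\mathbb{F}_{q^n}})$, and $L_U$ is scattered if every point has weight one; it is maximum scattered if it is scattered of rank $n$. Two linear sets are equivalent if some element of $\mathrm{P}\Gamma\mathrm{L}(2,q^n)$ maps one onto the other. A linear set of a line is of LP-type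 (Lunardon–Polverino type) if it is equivalent to a maximum scattered linear set $L^n_{s,\delta}=\{\langle (x,\delta x^{q^s}+x^{q^{n-s}})\rangle_{\mathbb{F}_{q^n}}: x\in\mathbb{F}_{q^n}^*\}$ for some $\delta\in\mathbb{F}_{q^n}^*$ and some $s$ with $\gcd(s,n)=1$.
   Formalization: Uniqueness of P is asserted only for n ≥ 5: for n = 4 the equation is Γ = ⟨P,Q⟩ with Γ a line, so every point of Γ serves as P and uniqueness fails; existence, and the LP-type claim for every such P, are kept for all n ≥ 4. *)

(* Defs.v *)
From HB Require Import structures.
From mathcomp Require Import all_boot all_order all_algebra all_field.

Set Implicit Arguments.
Unset Strict Implicit.
Unset Printing Implicit Defensive.

Import Order.TTheory GRing.Theory Num.Theory.
Local Open Scope ring_scope.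

(* Throughout, F is the field F_q with q = #|F|, and K is a field extension of
   F of finite degree n, that is, F_{q^n}.  The subspaces of PG(V, K) are the
   elements of {vspace V}; the empty subspace is 0%VS. *)

(* V regarded as a vector space over F; its F-subspaces are the elements of
   {vspace restrict_scalars V}. *)
Definition restrict_scalars (F : fieldType) (K : fieldExtType F)
  (V : vectType K) : Type := V.

Section RestrictScalars.
Variables (F : fieldType) (K : fieldExtType F) (V : vectType K).
Local Notation VF := (restrict_scalars V).

HB.instance Definition _ := GRing.Zmodule.on VF.

Definition rs_scale (a : F) (v : VF) : VF := (a%:A : K) *: (v : V).

Fact rs_scaleA a b v : rs_scale a (rs_scale b v) = rs_scale (a * b) v.
Proof. by rewrite /rs_scale scalerA mulr_algl scalerA. Qed.
Fact rs_scale1 : left_id 1 rs_scale.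
Proof. by move=> v; rewrite /rs_scale !scale1r. Qed.
Fact rs_scaleDr : right_distributive rs_scale +%R.
Proof. by move=> a u v; rewrite /rs_scale scalerDr. Qed.
Fact rs_scaleDl v : {morph rs_scale^~ v : a b / a + b}.
Proof. by move=> a b; rewrite /rs_scale -scalerDl -scalerDl. Qed.

HB.instance Definition _ := GRing.Zmodule_isLmodule.Build F VF
  rs_scaleA rs_scale1 rs_scaleDr rs_scaleDl.

Lemma rs_scaleE (a : F) (v : VF) : a *: v = (a%:A : K) *: (v : V) :> V.
Proof. by []. Qed.

Fact rs_vect_iso : Vector.axiom (\dim {:V} * \dim {:K}) VF.
Proof.
pose bV := vbasis {:V}; pose bK := vbasis {:K}.
set m := \dim {:V} in bV *; set n := \dim {:K} in bK *.
pose v2r (x : VF) := mxvec (\matrix_(i < m, j < n) coord bK j (coord bV i (x : V))).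
have v2r_lin : linear v2r.
  move=> a x y; rewrite -linearP; congr mxvec; apply/matrixP=> i j.
  rewrite !mxE.
  have -> : coord bV i (a *: x + y : VF) = a *: coord bV i x + coord bV i y.
    by rewrite -[a *: _ in RHS]mulr_algl -linearP.
  by rewrite linearP.
pose r2v r : VF := \sum_(i < m) (\sum_(j < n) vec_mx r i j *: bK`_j) *: bV`_i.
exists v2r => //; exists r2v => [x|r].
  rewrite [RHS](coord_vbasis (memvf (x : V))); apply: eq_bigr => i _.
  rewrite mxvecK; congr (_ *: _ : V).
  by rewrite [RHS](coord_vbasis (memvf _)); apply: eq_bigr => j _; rewrite mxE.
apply: (canLR vec_mxK); apply/matrixP=> i j; rewrite mxE.
by rewrite !coord_sum_free ?(basis_free (vbasisP _)).
Qed.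

HB.instance Definition _ := Lmodule_hasFinDim.Build F VF rs_vect_iso.

(* A K-subspace regarded as an F-subspace, obtained as the image of a
   projection; mem_rs_vspace is its characterization. *)
Definition rs_vspace (W : {vspace V}) : {vspace VF} :=
  limg (linfun (projv W : VF -> VF)).

Lemma mem_rs_vspace (W : {vspace V}) : (rs_vspace W : {pred V}) =i W.
Proof.
have plin : linear (projv W : VF -> VF) by move=> a u v; rewrite !rs_scaleE linearP.
pose pM := GRing.isLinear.Build F VF VF *:%R (projv W : VF -> VF) plin.
pose p : {linear VF -> VF} := HB.pack (projv W : VF -> VF) pM.
have pE v : linfun (projv W : VF -> VF) v = projv W v by exact: (lfunE p v).
move=> v; apply/idP/idP => [/memv_imgP[u _ ->]|vW].
  by rewrite pE memv_proj.
by apply/memv_imgP; exists v; rewrite ?memvf // pE projv_id.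
Qed.

End RestrictScalars.

Section ProjectiveGeometry.
Variables (F : finFieldType) (K : fieldExtType F).

(* Projective dimension; the empty subspace has dimension -1. *)
Definition pdim (V : vectType K) (W : {vspace V}) : int := (\dim W)%:Z - 1.

Definition is_point (V : vectType K) (X : {vspace V}) : Prop := pdim X = 0.

Definition pointset (V : vectType K) : Type := {vspace V} -> Prop.

(* L_U, the set of points <u>_K with u a nonzero vector of U. *)
Definition linear_set (V : vectType K) (U : {vspace restrict_scalars V}) :
    pointset V :=
  fun X => exists u : V, [/\ u \in U, u != 0 & X = <[u]>%VS].

Definition canonical_subgeometry (V : vectType K) (Sigma : pointset V) : Prop :=
  exists S : {vspace restrict_scalars V},
    [/\ \dim S = \dim {:V},
        (<<(vbasis S : seq V)>> = fullv :> {vspace V})%VS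
      & forall X, Sigma X <-> linear_set S X].

(* The maps on subspaces induced by the semilinear bijections.  For V1 = V2
   these are the elements of PGammaL, identified with their action. *)
Definition collineation (V1 V2 : vectType K)
    (f : {vspace V1} -> {vspace V2}) : Prop :=
  exists (tau : {rmorphism K -> K}) (phi : {linear V1 -> V2 | tau \; *:%R}),
    [/\ bijective tau, bijective phi
      & forall (W : {vspace V1}) (v : V1), (phi v \in f W) = (v \in W)].

Definition fixes_pointwise (V : vectType K) (Sigma : pointset V)
    (f : {vspace V} -> {vspace V}) : Prop :=
  collineation f /\ forall X, Sigma X -> f X = X.

(* The pointwise stabilizer is finite, so nonnegative powers suffice. *)
Definition generates_stabilizer (V : vectType K) (Sigma : pointset V)
    (sigma : {vspace V} -> {vspace V}) : Prop :=
  fixes_pointwise Sigma sigma /\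
  forall g, fixes_pointwise Sigma g -> exists k : nat, g =1 iter k sigma.

(* The projection of Sigma from Gamma to Lambda, as a set of points of
   PG(Lambda, K). *)
Definition projection (V : vectType K) (Gamma Lambda : {vspace V})
    (Sigma : pointset V) : pointset (subvs_of Lambda) :=
  fun Y => exists2 X, Sigma X &
    (linfun (vsval : subvs_of Lambda -> V) @: Y = (Gamma + X) :&: Lambda)%VS.

Definition intn_cond (V : vectType K) (sigma : {vspace V} -> {vspace V})
    (Gamma : {vspace V}) (r : nat) : bool :=
  (0 < r)%N &&
  (pdim Gamma - (2 * r)%:Z < pdim (\bigcap_(i < r.+1) iter i sigma Gamma)%VS).

Fact intn_exists (V : vectType K) (sigma : {vspace V} -> {vspace V})
  (Gamma : {vspace V}) : exists r, intn_cond sigma Gamma r.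
Proof.
exists (\dim Gamma).+1; rewrite /intn_cond /pdim /=.
rewrite addrAC ltrD2r ltrBlDr -PoszD ltz_nat mul2n -addnn.
by apply: leq_trans (leq_addl _ _); rewrite leq_addr.
Qed.

Definition intn (V : vectType K) (sigma : {vspace V} -> {vspace V})
    (Gamma : {vspace V}) : nat := ex_minn (intn_exists sigma Gamma).

Definition scattered_linear_set (V : vectType K) (rho : nat)
    (A : pointset V) : Prop :=
  exists U : {vspace restrict_scalars V},
    [/\ \dim U = rho,
        forall X, A X <-> linear_set U X
      & forall X, A X -> \dim (U :&: rs_vspace X) = 1%N].

Definition max_scattered (V : vectType K) (A : pointset V) : Prop :=
  scattered_linear_set (\dim {:K}) A.

Definition equivalent (V1 V2 : vectType K)
    (A : pointset V1) (B : pointset V2) : Prop :=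
  exists f : {vspace V1} -> {vspace V2},
    collineation f /\ forall X, A X <-> B (f X).

(* L^n_{s,delta} in PG(K * K, K) = PG(1, q^n). *)
Definition LP_set (s : nat) (delta : K) : pointset (K^o * K^o)%type :=
  fun X => exists2 x : K, x != 0 &
    X = <[(x, delta * x ^+ (#|F| ^ s) + x ^+ (#|F| ^ (\dim {:K} - s)))%R
          : K^o * K^o]>%VS.

Definition LP_type (V : vectType K) (A : pointset V) : Prop :=
  exists (s : nat) (delta : K),
    [/\ (0 < s < \dim {:K})%N, coprime s (\dim {:K}), delta != 0,
        max_scattered (LP_set s delta) & equivalent A (LP_set s delta)].

(* P is a point and Gamma = <P, P^sigma, ..., P^(sigma^(n-4)), Q> for some
   point Q.  If n = 4 this is Gamma = <P, Q>, which is symmetric in P and Q, so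
   that such a P is never unique. *)
Definition spanned_by_orbit (V : vectType K) (n : nat)
    (sigma : {vspace V} -> {vspace V}) (Gamma P : {vspace V}) : Prop :=
  is_point P /\
  exists2 Q : {vspace V}, is_point Q &
    (Gamma = (\sum_(i < n - 3) iter i sigma P) + Q)%VS.

End ProjectiveGeometry.

Arguments projection {F K V} Gamma Lambda Sigma _.

(* Main.v *)
Require Import Defs.
From mathcomp Require Import all_boot all_order all_algebra all_field.
From HB Require Import structures.
From mathcomp Require Import all_fingroup all_solvable.
From mathcomp Require Import zify ring.
Local Open Scope ring_scope.

(* In a basis of the F-subspace S defining Sigma, sigma is induced
   by the map phi applying a generator tau = (x |-> x^(q^s)) of Gal(K/F) to all
   coordinates; phi^n = 1, S is the fixed space of phi, and every nonzero
   sigma-invariant subspace contains a point of Sigma.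

   Since Gamma has no nonzero invariant subspace, intn = 2 forces
   U = Gamma :&: Gamma^sigma to have dimension n - 4 and U :&: U^sigma to have
   dimension n - 5.  Iterating W |-> W :&: W^sigma from U then drops the
   dimension by exactly one at each step, and the last nonzero term is a point,
   which is P^(sigma^(n-4)).

   For the second part write P = <p>, v_i = phi^i p and
   a v_(n-3) + b v_(n-1) \in Gamma.  The dimension of U gives a, b != 0, and
   Gamma meets no line of Sigma because L is scattered, which makes
   v_0, ..., v_(n-1) a basis.
   In the coordinates x_i relative to it, Gamma is the kernel of
   x |-> (x_(n-2), x_(n-3) + delta x_(n-1)) with delta = - a / b, and S is
   { sum_i tau^i(y) v_i }; so S is mapped onto the pairs
   (x, delta tau(x) + tau^-1(x)), which is the set defining L^n_(s,delta). *)

Set Implicit Arguments.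
Unset Strict Implicit.
Unset Printing Implicit Defensive.
Import GRing.Theory.

(** * Orbits of a semilinear map *)

Section SemilinearOrbits.
Variables (K : fieldType) (V : vectType K) (tau : {rmorphism K -> K}).
Variables (phi : {linear V -> V | tau \; *:%R}) (sigma : {vspace V} -> {vspace V}).
Variable n : nat.
Hypothesis n_gt0 : (0 < n)%N.
Hypothesis sigmaP : forall (W : {vspace V}) (v : V), (phi v \in sigma W) = (v \in W).
Hypothesis iter_phi_n : forall v : V, iter n phi v = v.

Lemma phiZ a v : phi (a *: v) = tau a *: phi v.
Proof. exact: linearZ. Qed.

Lemma phi_surj v : exists u, v = phi u.
Proof. by exists (iter n.-1 phi v); rewrite -iterS prednK. Qed.

Lemma phi_inj : injective phi.
Proof.
by move=> u v uv; rewrite -(iter_phi_n u) -(iter_phi_n v) -(prednK n_gt0) !iterSr uv.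
Qed.

Lemma phi_eq0 v : (phi v == 0) = (v == 0).
Proof. by rewrite -{1}(linear0 phi) (inj_eq phi_inj). Qed.

Lemma iter_phi_eq0 k v : (iter k phi v == 0) = (v == 0).
Proof. by elim: k => //= k IHk; rewrite phi_eq0. Qed.

Lemma sigmaS A B : (sigma A <= sigma B)%VS = (A <= B)%VS.
Proof.
apply/subvP/subvP => [sAB v | sAB v]; first by rewrite -(sigmaP A) -(sigmaP B); apply: sAB.
by have [u ->] := phi_surj v; rewrite !sigmaP; apply: sAB.
Qed.

Lemma sigma_inj A B : sigma A = sigma B -> A = B.
Proof. by move=> AB; apply/eqP; rewrite eqEsubv -(sigmaS A) -(sigmaS B) AB subvv. Qed.

Lemma sigma_line v : sigma <[v]> = <[phi v]>%VS.
Proof.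
apply/vspaceP=> x; have [u ->] := phi_surj x; rewrite sigmaP.
apply/vlineP/vlineP => [[k ->]|[k phiu]]; first by exists (tau k); rewrite phiZ.
have [v0|v0] := eqVneq v 0.
  by exists 0; apply/eqP; rewrite scale0r -phi_eq0 phiu v0 linear0 scaler0.
(* the scalar k is a value of tau because some power of phi is the identity *)
pose f := iter n tau.
have fE c w : iter n phi (c *: w) = f c *: iter n phi w.
  by rewrite /f; elim: n => //= i ->; rewrite phiZ.
have fK c : f c = c.
  have := fE c v; rewrite !iter_phi_n => /eqP; rewrite -subr_eq0 -scalerBl scaler_eq0.
  by rewrite (negPf v0) orbF subr_eq0 => /eqP.
exists (iter n.-1 tau k); apply: phi_inj.
by rewrite phiZ -iterS prednK // -/(f k) fK.
Qed.

Lemma sigmaD A B : sigma (A + B)%VS = (sigma A + sigma B)%VS.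
Proof.
apply/eqP; rewrite eqEsubv subv_add !sigmaS addvSl addvSr !andbT.
apply/subvP=> x; have [u ->] := phi_surj x; rewrite sigmaP => /memv_addP[a aA [b bB ->]].
by rewrite linearD memv_add // sigmaP.
Qed.

Lemma sigma_cap A B : sigma (A :&: B)%VS = (sigma A :&: sigma B)%VS.
Proof.
by apply/vspaceP=> x; have [u ->] := phi_surj x; rewrite memv_cap !sigmaP memv_cap.
Qed.

Lemma sigma0 : sigma 0%VS = 0%VS.
Proof.
by apply/vspaceP=> x; have [u ->] := phi_surj x; rewrite sigmaP !memv0 phi_eq0.
Qed.

(** The images of a basis span [sigma W], so [sigma] never raises the dimension; as its n-th power
    is the identity, it cannot lower it either. *)
Lemma dim_sigma W : \dim (sigma W) = \dim W.
Proof.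
have le A : (\dim (sigma A) <= \dim A)%N.
  rewrite -{1}(span_basis (vbasisP A)) -{2}(size_tuple (vbasis A)).
  elim: (vbasis A : seq V) => [|v s IHs]; first by rewrite span_nil sigma0 dimv0.
  rewrite span_cons sigmaD sigma_line /=.
  apply: leq_trans (dimv_add_leqif _ _) _; rewrite -add1n leq_add //.
  by rewrite dim_vline; case: (_ != _).
have iterP k A v : (iter k phi v \in iter k sigma A) = (v \in A).
  by elim: k => //= k IHk; rewrite sigmaP.
have iter_id A : iter n sigma A = A.
  by apply/vspaceP=> v; rewrite -{1}(iter_phi_n v) iterP.
apply/eqP; rewrite eqn_leq le /= -{1}(iter_id W) -(prednK n_gt0) iterSr.
by elim: n.-1 => //= k; apply: leq_trans.
Qed.

Lemma sigma_sub_fix W : (sigma W <= W)%VS -> sigma W = W.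
Proof. by move=> sW; apply/eqP; rewrite eqEdim sW dim_sigma /=. Qed.

Lemma iter_sigma_line k v : iter k sigma <[v]>%VS = <[iter k phi v]>%VS.
Proof. by elim: k => //= k ->; rewrite sigma_line. Qed.

Definition orbit_span (p : V) (k : nat) : {vspace V} := (\sum_(i < k) <[iter i phi p]>)%VS.

Lemma orbit_spanSr p k : orbit_span p k.+1 = (orbit_span p k + <[iter k phi p]>)%VS.
Proof. by rewrite /orbit_span big_ord_recr. Qed.

Lemma orbit_spanSl p k : orbit_span p k.+1 = (<[p]> + orbit_span (phi p) k)%VS.
Proof.
by rewrite /orbit_span big_ord_recl; congr addv; apply: eq_bigr => i _; rewrite -iterSr.
Qed.

Lemma sigma_orbit_span p k : sigma (orbit_span p k) = orbit_span (phi p) k.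
Proof.
elim: k => [|k IHk]; first by rewrite /orbit_span !big_ord0 sigma0.
by rewrite !orbit_spanSr sigmaD IHk sigma_line -iterS iterSr.
Qed.

Lemma orbit_span_sub p k W :
  (orbit_span p k <= W)%VS <-> (forall i, (i < k)%N -> iter i phi p \in W).
Proof.
split=> [/subv_sumP H i ik | H]; first by rewrite memvE; apply: (H (Ordinal ik)).
by apply/subv_sumP=> i _; rewrite -memvE H.
Qed.

Lemma mem_orbit_span p k i : (i < k)%N -> iter i phi p \in orbit_span p k.
Proof. by move/(proj1 (orbit_span_sub p k _) (subvv _)). Qed.

Lemma orbit_spanS p k l : (k <= l)%N -> (orbit_span p k <= orbit_span p l)%VS.
Proof.
by move=> kl; apply/orbit_span_sub=> i ik; rewrite mem_orbit_span ?(leq_trans ik).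
Qed.

Lemma dim_orbit_span_le p k : (\dim (orbit_span p k) <= k)%N.
Proof.
elim: k => [|k IHk]; first by rewrite /orbit_span big_ord0 dimv0.
rewrite orbit_spanSr; apply: leq_trans (dimv_add_leqif _ _) _.
by rewrite -addn1 leq_add // dim_vline; case: (_ != _).
Qed.

Lemma sigma_orbit_span_n p : sigma (orbit_span p n) = orbit_span p n.
Proof.
apply: sigma_sub_fix; rewrite sigma_orbit_span; apply/orbit_span_sub=> i ik.
rewrite -iterSr; have [->|ne] := eqVneq i.+1 n.
  by rewrite iter_phi_n -[X in X \in _]/(iter 0 phi p) mem_orbit_span.
by rewrite mem_orbit_span //; lia.
Qed.

(** The form in which the disjointness of Gamma and Sigma enters the orbit arguments. Inclusion is
    enough to express invariance, since [sigma] preserves dimension. *)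
Definition no_invariant (U : {vspace V}) : Prop :=
  forall W, (W <= U)%VS -> (sigma W <= W)%VS -> W = 0%VS.

Lemma no_invariantS A B : (A <= B)%VS -> no_invariant B -> no_invariant A.
Proof. by move=> AB H W WA; apply: H; apply: subv_trans AB. Qed.

(** If [iter k phi p] fell into the span of its predecessors, that span would be invariant inside
    [U], hence zero, yet it would contain a nonzero vector. *)
Lemma dim_orbit_span p k U :
  no_invariant U -> p != 0 -> (orbit_span p k <= U)%VS -> \dim (orbit_span p k) = k.
Proof.
move=> noinv p0; elim: k => [|k IHk] sub; first by rewrite /orbit_span big_ord0 dimv0.
have sub_k : (orbit_span p k <= U)%VS by apply: subv_trans sub; apply: orbit_spanS.
have dim_k := IHk sub_k.
rewrite orbit_spanSr dimv_disjoint_sum ?dim_k ?dim_vline ?iter_phi_eq0 ?p0 ?addn1 //.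
have [->|ne] := eqVneq (orbit_span p k :&: <[iter k phi p]>)%VS 0%VS => //.
have pk : iter k phi p \in orbit_span p k.
  have : (<[iter k phi p]> <= orbit_span p k)%VS.
    have /eqP <- : (orbit_span p k :&: <[iter k phi p]> == <[iter k phi p]>)%VS; last exact: capvSl.
    by rewrite eqEdim capvSr dim_vline iter_phi_eq0 p0 lt0n dimv_eq0.
  by rewrite memvE.
have : orbit_span p k = 0%VS.
  apply: noinv sub_k _; rewrite sigma_orbit_span; apply/orbit_span_sub=> i ik.
  rewrite -iterSr; have [->//|ne'] := eqVneq i.+1 k.
  by rewrite mem_orbit_span //; lia.
by move=> orb0; move: pk; rewrite orb0 memv0 iter_phi_eq0 (negPf p0).
Qed.

(** [T j] consists of the vectors [iter j phi y] for which y, ..., [iter j phi y] all lie in [U].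
    Each step loses exactly one dimension, so [T m] is a line, and it determines the line of [r]
    because [sigma] is injective. *)
Lemma unique_orbit_point (U : {vspace V}) m :
  no_invariant U -> \dim U = m.+1 -> (m <= \dim (U :&: sigma U))%N ->
  exists2 r : V, r != 0 /\ (forall i, (i < m.+1)%N -> iter i phi r \in U)
    & forall r' : V, r' != 0 -> (forall i, (i < m.+1)%N -> iter i phi r' \in U) ->
        <[r']>%VS = <[r]>%VS.
Proof.
move=> noinv dimU dimU1; pose T j := iter j (fun W => W :&: sigma W)%VS U.
have TS j : T j.+1 = (T j :&: sigma (T j))%VS by [].
have subT j : (T j <= U)%VS.
  by elim: j => [|j IHj]; [exact: subvv | exact: subv_trans (capvSl _ _) IHj].
(* Without a drop, [T j] would lie in its image and be invariant inside [U]. *)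
have drop j : T j != 0%VS -> (\dim (T j.+1) < \dim (T j))%N.
  move=> Tj0; rewrite ltnNge; apply: contraNN Tj0 => le; apply/eqP.
  apply: noinv (subT j) _.
  have /eqP eqT : (T j :&: sigma (T j) == T j)%VS by rewrite eqEdim capvSl.
  have : (T j <= sigma (T j))%VS by rewrite -{1}eqT capvSr.
  by move=> sub; have /eqP <- : T j == sigma (T j) by rewrite eqEdim sub dim_sigma /=.
have dimT j : (j <= m)%N -> \dim (T j) = (m.+1 - j)%N /\ (m - j <= \dim (T j.+1))%N.
  elim: j => [|j IHj] jm; first by rewrite !subn0.
  have [dj dj1] := IHj (ltnW jm).
  have dimTS : \dim (T j.+1) = (m.+1 - j.+1)%N.
    have : (\dim (T j.+1) < \dim (T j))%N by apply: drop; rewrite -dimv_eq0 dj; lia.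
    by rewrite dj; lia.
  split=> //.
  (* [T j.+1] and its image both lie in [sigma (T j)], so the dimension formula keeps the next drop
     down to one. *)
  have : (\dim (T j.+1 + sigma (T j.+1)) <= \dim (sigma (T j)))%N.
    by apply: dimvS; rewrite subv_add sigmaS !TS capvSr capvSl.
  have := dimv_sum_cap (T j.+1) (sigma (T j.+1)).
  rewrite -TS !dim_sigma dimTS dj; lia.
have [dimTm _] := dimT m (leqnn m).
have memT j x : x \in T j -> exists2 y, x = iter j phi y & forall i, (i <= j)%N -> iter i phi y \in U.
  elim: j x => [|j IHj] x; first by exists x => // i; rewrite leqn0 => /eqP->.
  rewrite TS memv_cap => /andP[xT]; have [z xz] := phi_surj x.
  rewrite xz sigmaP => /IHj[y zy Hy]; exists y; rewrite ?zy // => i.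
  rewrite leq_eqVlt => /orP[/eqP->|/Hy//].
  by rewrite /= -zy -xz; apply: (subvP (subT j)).
have Tmem j i x : (forall i, (i < m.+1)%N -> iter i phi x \in U) ->
    (j <= i <= m)%N -> iter i phi x \in T j.
  move=> Hx; elim: j i => [|j IHj] i jim; first by apply: Hx; lia.
  rewrite TS memv_cap IHj; last by lia.
  case: i jim => [|i] jim; first by lia.
  by rewrite /= sigmaP IHj //; lia.
have [t tT] : exists2 t, t \in T m & t != 0.
  exists (vpick (T m)); first exact: memv_pick.
  by rewrite vpick0 -dimv_eq0 dimTm; lia.
have [r tr Hr] := memT _ _ tT => t0.
have lineT x : x != 0 -> x \in T m -> <[x]>%VS = T m.
  move=> x0 xT; apply/eqP; rewrite eqEdim -memvE xT dim_vline x0 dimTm; lia.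
exists r.
  split; last by move=> i; rewrite ltnS; apply: Hr.
  by move: t0; rewrite tr iter_phi_eq0.
move=> r' r'0 Hr'.
have iter_sigma_inj k : injective (iter k sigma).
  by elim: k => // k IHk A B /= /sigma_inj/IHk.
apply: (iter_sigma_inj m); rewrite !iter_sigma_line !lineT ?iter_phi_eq0 ?r'0 //.
- by rewrite -(iter_phi_eq0 m) -tr.
- by rewrite -tr.
- by apply: Tmem => //; rewrite leqnn.
Qed.

(** A run of m + 1 orbit vectors in [G :&: sigma G] is the same as a run of m + 2 orbit vectors in
    [G] that starts one step earlier; hence [r] is taken as [phi p]. *)
Lemma exists_orbit_point (G : {vspace V}) m :
  no_invariant G -> \dim {:V} = m.+4.+1 -> \dim G = m.+3 ->
  (\dim (G :&: sigma G) <= m.+1)%N ->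
  (m <= \dim (G :&: sigma G :&: sigma (G :&: sigma G)))%N ->
  exists2 p : V, p != 0 /\ (orbit_span p m.+2 <= G)%VS
    & forall p' : V, p' != 0 -> (orbit_span p' m.+2 <= G)%VS -> <[p']>%VS = <[p]>%VS.
Proof.
move=> noinv dimV dimG dimU_le dimU1; set U := (G :&: sigma G)%VS in dimU_le dimU1.
have dimU : \dim U = m.+1.
  have := dimv_sum_cap G (sigma G); have := dimvS (subvf (G + sigma G)).
  by rewrite dim_sigma dimV dimG; rewrite -/U in dimU_le *; lia.
have noinvU : no_invariant U by apply: no_invariantS noinv; apply: capvSl.
have [r [r0 Hr] uniq_r] := unique_orbit_point noinvU dimU dimU1.
have [p rp] := phi_surj r; exists p.
  split; first by rewrite -phi_eq0 -rp.
  apply/orbit_span_sub=> -[_|i im].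
    by move: (Hr 0 isT); rewrite /= rp memv_cap sigmaP => /andP[].
  by rewrite iterSr -rp; apply: (subvP (capvSl G (sigma G))); apply: Hr.
move=> p' p'0 /orbit_span_sub Hp'.
apply: sigma_inj; rewrite !sigma_line -rp; apply: uniq_r; first by rewrite phi_eq0.
move=> i im; rewrite -iterSr memv_cap Hp' //= sigmaP Hp' //; lia.
Qed.

Lemma orbit_span_complement (G : {vspace V}) p k :
  no_invariant G -> p != 0 -> (orbit_span p k <= G)%VS -> \dim G = k.+1 ->
  exists2 Q : {vspace V}, \dim Q = 1 & G = (orbit_span p k + Q)%VS.
Proof.
move=> noinv p0 sub dimG; exists (G :\: orbit_span p k)%VS; last first.
  by rewrite addvC addv_diff; apply/esym/addv_idPl.
have := dimv_cap_compl G (orbit_span p k).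
by rewrite (capv_idPr sub) (dim_orbit_span noinv p0 sub) dimG; lia.
Qed.

(** A run of k + 1 orbit vectors in [G] has its last k in [G :&: sigma G], where they are
    independent. *)
Lemma orbit_span_not_sub (G : {vspace V}) p k :
  no_invariant G -> p != 0 -> (\dim (G :&: sigma G) < k)%N -> ~~ (orbit_span p k.+1 <= G)%VS.
Proof.
move=> noinv p0; rewrite ltnNge; apply: contraNN => sub.
have subk : (orbit_span p k <= G)%VS by apply: subv_trans sub; apply: orbit_spanS.
rewrite -{1}(dim_orbit_span noinv p0 subk) -dim_sigma; apply: dimvS.
rewrite subv_cap sigmaS subk andbT sigma_orbit_span.
by move: sub; rewrite orbit_spanSl subv_add => /andP[].
Qed.

(** The third hypothesis is what scatteredness provides; it forces M + G to be the whole space. A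
    proper [M] would then be a hyperplane meeting [G] exactly in [H], and the relation between the
    orbit vectors would confine the orbit to a span of n - 2 of them. *)
Lemma orbit_span_full (G : {vspace V}) p a b :
  (4 <= n)%N -> \dim {:V} = n -> \dim G = (n - 2)%N -> no_invariant G ->
  (forall M, (sigma M <= M)%VS -> (\dim (M + G) < n)%N -> (\dim M <= 1)%N) ->
  (\dim (G :&: sigma G) < n - 3)%N -> p != 0 -> (orbit_span p (n - 3) <= G)%VS ->
  a *: iter (n - 3) phi p + b *: iter (n - 1) phi p \in G -> (a, b) != (0, 0) ->
  [/\ a != 0, b != 0 & orbit_span p n = fullv].
Proof.
move=> n4 dimV dimG noinv scat dimU p0 sub wG ab0.
have mem0 v c : c != 0 -> c *: v \in G -> v \in G by move=> c0; rewrite rpredZeq (negPf c0).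
have b0 : b != 0.
  apply: contraTneq wG => b0; rewrite b0 scale0r addr0.
  have a0 : a != 0 by apply: contraNneq ab0 => a0; rewrite a0 b0.
  apply: contraNN (orbit_span_not_sub noinv p0 dimU) => /(mem0 _ _ a0) pG.
  by rewrite orbit_spanSr subv_add sub -memvE.
(* If a = 0, the run of n - 2 orbit vectors in [G] starts at [iter (n - 1) phi p], which [phi] sends
   to [p]. *)
have a0 : a != 0.
  apply: contraTneq wG => a0; rewrite a0 scale0r add0r.
  have q0 : iter (n - 1) phi p != 0 by rewrite iter_phi_eq0.
  apply: contraNN (orbit_span_not_sub noinv q0 dimU) => /(mem0 _ _ b0) pG.
  rewrite orbit_spanSl -iterS subn1 prednK // iter_phi_n subv_add sub andbT.
  by rewrite -memvE -subn1.
split=> //; set M := orbit_span p n; set H := orbit_span p (n - 3).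
have invM : (sigma M <= M)%VS by rewrite sigma_orbit_span_n.
have dimH : \dim H = (n - 3)%N := dim_orbit_span noinv p0 sub.
have subHM : (H <= M :&: G)%VS by rewrite subv_cap sub orbit_spanS ?leq_subr.
have dimMG : \dim (M + G) = n.
  have := dimvS (subvf (M + G)); rewrite dimV leq_eqVlt => /orP[/eqP//|lt].
  have M1 := scat M invM lt; have le_cap := dimvS subHM.
  (* [M] has dimension at most 1 and meets [G] in at least [H], of dimension n - 3 > 0; so it lies
     in [G] and vanishes. *)
  have M0 : M = 0%VS.
    apply: noinv invM; have /eqP <- : (M :&: G == M)%VS; last exact: capvSr.
    by rewrite eqEdim capvSl /=; move: M1 le_cap n4; rewrite dimH; clear; lia.
  by move: le_cap n4; rewrite dimH M0 cap0v dimv0; clear; lia.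
have capM := dimv_sum_cap M G; have le_cap := dimvS subHM.
apply/eqP; rewrite eqEdim subvf dimV leqNgt; apply/negP => ltM.
have dimM : \dim M = (n - 1)%N by move: capM le_cap ltM dimMG dimG dimH n4; clear; lia.
have capE : (M :&: G = H)%VS by apply/esym/eqP; rewrite eqEdim subHM /=; move: capM dimMG dimM dimG dimH n4; clear; lia.
have wH : a *: iter (n - 3) phi p + b *: iter (n - 1) phi p \in H.
  by rewrite -capE memv_cap wG andbT memvD ?memvZ ?mem_orbit_span //; move: n4; clear; lia.
have pn1 : iter (n - 1) phi p \in orbit_span p (n - 2).
  have -> : (n - 2 = (n - 3).+1)%N by move: n4; clear; lia.
  have : b *: iter (n - 1) phi p \in orbit_span p (n - 3).+1.
    rewrite -[b *: _](addKr (a *: iter (n - 3) phi p)) memvD ?memvN //.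
      by rewrite memvZ // mem_orbit_span.
    by apply: (subvP _ _ wH); apply: orbit_spanS.
  by rewrite rpredZeq (negPf b0).
(* applying phi once more closes the orbit up one step too early *)
have p_in : p \in orbit_span (phi p) (n - 2).
  by move: pn1; rewrite -sigmaP sigma_orbit_span -iterS subn1 prednK // iter_phi_n.
have : (M <= orbit_span (phi p) (n - 2))%VS.
  apply/orbit_span_sub=> -[//|i] i_n; rewrite iterSr.
  have [i_lt|i_ge] := ltnP i (n - 2); first exact: mem_orbit_span.
  have -> : (i = n - 2)%N by move: i_n i_ge n4; clear; lia.
  rewrite -iterSr; have -> : ((n - 2).+1 = n - 1)%N by move: n4; clear; lia.
  apply: (subvP _ _ pn1); apply/orbit_span_sub=> -[//|j] j_n.
  by rewrite iterSr mem_orbit_span //; move: j_n; clear; lia.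
move/dimvS; have := dim_orbit_span_le (phi p) (n - 2); rewrite dimM.
by move: n4; clear; lia.
Qed.

End SemilinearOrbits.

(** * The pointwise stabilizer of a subgeometry *)

Section Frobenius.
Variables (F : finFieldType) (K : fieldExtType F).

Definition frob (x : K) : K := x ^+ #|F|.

Fact frob_is_zmod_morphism : zmod_morphism frob.
Proof.
move=> x y; have [p pr_p pF] := finPcharP F.
have pK : p \in [pchar K] by rewrite (@pchar_lalg F K).
have := card_pprimeChar pF; move: (logn p _) => e cardF.
rewrite /frob cardF; elim: e {cardF} => [|e IHe]; first by rewrite !expr1.
by rewrite expnSr !exprM IHe -!(pFrobenius_autE pK) rmorphB.
Qed.
HB.instance Definition _ := GRing.isZmodMorphism.Build K K frob frob_is_zmod_morphism.

Fact frob_is_monoid_morphism : monoid_morphism frob.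
Proof. by split=> [|x y]; rewrite /frob ?expr1n ?exprMn. Qed.
HB.instance Definition _ := GRing.isMonoidMorphism.Build K K frob frob_is_monoid_morphism.

Lemma frob_scalar (c : F) : frob c%:A = c%:A.
Proof. by rewrite /frob -[c%:A]/(in_alg K c) -rmorphXn expf_card. Qed.

Lemma frob_fixed (x : K) : frob x = x -> exists c : F, x = c%:A.
Proof.
move=> fx; apply/vlineP; rewrite (Fermat's_little_theorem 1%AS) dimv1 expn1.
by rewrite -/(frob x) fx.
Qed.

Lemma iter_frob k x : iter k frob x = x ^+ (#|F| ^ k).
Proof. by elim: k x => //= k IHk x; rewrite IHk /frob -exprM expnSr. Qed.

End Frobenius.

(** The Frobenius generates the Galois group and is a power of [tau], so [tau] generates it too: its
    order is the degree, and it is a power of the Frobenius with exponent prime to the degree. *)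
Lemma frob_generator (F : finFieldType) (K : fieldExtType F) (tau : {rmorphism K -> K}) k :
  (forall c : F, tau c%:A = c%:A) -> (forall x, iter k tau x = frob x) ->
  (1 < \dim {:K})%N ->
  (forall x, iter (\dim {:K}) tau x = x) /\
  exists s, [/\ (0 < s < \dim {:K})%N, coprime s (\dim {:K})
     & forall x, tau x = x ^+ (#|F| ^ s)].
Proof.
rewrite /frob; move: tau.
wlog [L -> {K}]: K / exists L : splittingFieldType F, K = L.
  by pose L := FinSplittingFieldType F K => /(_ L); apply; exists L.
move=> tau tauF tauk dimL.
have taul : linear tau.
  by move=> a x y; rewrite -mulr_algl rmorphD rmorphM tauF mulr_algl.
pose tauM := GRing.isLinear.Build F L L *:%R tau taul.
pose t : {linear L -> L} := HB.pack (tau : L -> L) tauM.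
have tE x : linfun t x = tau x by exact: (lfunE t).
have kAut_t : kAut 1 {:L} (linfun t).
  rewrite kAutfE; apply/kHomP; split=> [x y _ _|_ /vlineP[c ->]]; rewrite !tE ?rmorphM //.
have [g gGal gE] := kAut_to_gal kAut_t.
have gE' x : g x = tau x by rewrite -gE ?memvf.
have [a defG aE] := finField_galois_generator (sub1v {:L}).
have iterE (h : gal_of {:L}) i x : (h ^+ i)%g x = iter i h x.
  elim: i x => [|i IHi] x; first by rewrite expg0 gal_id.
  by rewrite expgSr galM ?memvf // IHi.
have ga : (g ^+ k)%g = a.
  apply/eqP/gal_eqP => x _; rewrite iterE aE ?memvf // dimv1 expn1 -tauk.
  exact: eq_iter.
have defGE : 'Gal({:L} / 1)%g = <[a]>%g by apply/eqP.
have ord_a : #[a]%g = \dim {:L}.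
  by rewrite orderE -defGE -galois_dim ?finField_galois ?sub1v // dimv1 divn1.
have ag : <[a]>%g = <[g]>%g.
  apply/eqP; rewrite eqEsubset !cycle_subG -{1}ga mem_cycle /=.
  by rewrite -defGE.
have ord_g : #[g]%g = \dim {:L} by rewrite orderE -ag -orderE.
split=> [x|].
  transitivity ((g ^+ \dim {:L})%g x); last by rewrite -ord_g expg_order gal_id.
  by rewrite iterE; apply: eq_iter => y.
have /cycleP[s0 gs0] : g \in <[a]>%g by rewrite -defGE.
pose s := (s0 %% #[a]%g)%N; have gs : g = (a ^+ s)%g by rewrite expg_mod_order.
have cop : coprime s (\dim {:L}).
  by rewrite coprime_sym -ord_a -generator_coprime -gs /generator ag.
have s_lt : (s < \dim {:L})%N by rewrite -ord_a ltn_mod order_gt0.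
exists s; split=> // [|x]; last first.
  rewrite -gE' gs iterE; elim: s {gs cop s_lt} => //= s IHs.
  by rewrite IHs aE ?memvf // dimv1 expn1 -exprM -expnSr.
(* s = 0 would make the gcd equal to the degree, which exceeds 1. *)
rewrite s_lt andbT lt0n; apply: contraTneq cop => ->.
by rewrite /coprime gcd0n neq_ltn dimL orbT.
Qed.

(** * Fixed vectors of a coordinatewise semilinear map *)

Section CoordinateSemilinear.
Variables (K : fieldType) (V : vectType K) (m : nat) (e : m.-tuple V).
Variable tau : {rmorphism K -> K}.

Definition coord_semilin (v : V) : V := \sum_(i < m) tau (coord e i v) *: e`_i.

Fact coord_semilin_is_linear : linear_for (tau \; *:%R) coord_semilin.
Proof.
move=> a u v; rewrite /coord_semilin /= scaler_sumr -big_split; apply: eq_bigr => i _.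
by rewrite linearP rmorphD rmorphM scalerDl scalerA.
Qed.
HB.instance Definition _ :=
  GRing.isLinear.Build K V V (tau \; *:%R) coord_semilin coord_semilin_is_linear.

Hypothesis e_basis : basis_of fullv e.

Lemma coord_sum_basis k j : coord e j (\sum_(i < m) k i *: e`_i) = k j.
Proof. by rewrite coord_sum_free // (basis_free e_basis). Qed.

Lemma coord_eqP u v : (forall i, coord e i u = coord e i v) -> u = v.
Proof.
move=> uv; rewrite (coord_basis e_basis (memvf u)) (coord_basis e_basis (memvf v)).
by apply: eq_bigr => i _; rewrite uv.
Qed.

Lemma coord_semilinE i v : coord e i (coord_semilin v) = tau (coord e i v).
Proof. exact: coord_sum_basis. Qed.

Lemma coord_iter_semilin k i v :
  coord e i (iter k coord_semilin v) = iter k tau (coord e i v).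
Proof. by elim: k => //= k <-; rewrite coord_semilinE. Qed.

Lemma coord_neq0 v : v != 0 -> exists i, coord e i v != 0.
Proof.
move=> v0; apply/existsP; apply: contraNT v0 => /existsPn v0.
apply/eqP/coord_eqP => i; rewrite linear0.
by have := v0 i; rewrite negbK => /eqP.
Qed.

(** Descent on the support: once some coordinate is scaled to 1, [coord_semilin v1 - v1] stays in
    [W], loses that coordinate and gains none. Either it is zero or the descent continues. *)
Lemma exists_fixed_vector (W : {vspace V}) :
  {in W, forall v, coord_semilin v \in W} -> W != 0%VS ->
  exists2 u, u \in W & u != 0 /\ coord_semilin u = u.
Proof.
move=> stabW W0; pose supp v := [set i | coord e i v != 0].
suff H k v : v \in W -> v != 0 -> (#|supp v| <= k)%N ->
    exists2 u, u \in W & u != 0 /\ coord_semilin u = u.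
  by apply: (H _ (vpick W) _ _ (leqnn _)); rewrite ?memv_pick ?vpick0.
elim: k v => [|k IHk] v vW v0; have [i vi] := coord_neq0 v0.
  by rewrite leqn0 cards_eq0 => /eqP/setP/(_ i); rewrite !inE vi.
move=> le_v; pose v1 := (coord e i v)^-1 *: v.
have v1W : v1 \in W by rewrite memvZ.
have v1i : coord e i v1 = 1 by rewrite linearZ /= mulVf.
have [d0|d0] := eqVneq (coord_semilin v1 - v1) 0.
  exists v1 => //; split; last by apply/eqP; rewrite -subr_eq0 d0.
  by apply: contra_eq_neq v1i => ->; rewrite linear0 eq_sym oner_eq0.
apply: (IHk (coord_semilin v1 - v1)) => //; first by rewrite memvB ?stabW.
rewrite -ltnS; apply: leq_trans le_v; apply: proper_card; apply/properP; split.
  apply/subsetP=> j; rewrite !inE; apply: contraNN => /eqP vj.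
  by rewrite linearB /= coord_semilinE linearZ /= vj mulr0 rmorph0 subr0.
exists i; first by rewrite inE.
by rewrite inE negbK linearB /= coord_semilinE v1i rmorph1 subrr.
Qed.

(** The second vector is sought where a nonzero coordinate of [u] vanishes: this hyperplane is
    stable, the map being coordinatewise, and meets [<[u]>] only in 0. *)
Lemma exists_two_fixed_vectors (W : {vspace V}) :
  {in W, forall v, coord_semilin v \in W} -> (1 < \dim W)%N ->
  exists u v, [/\ u \in W, u != 0, coord_semilin u = u
    & [/\ v \in W, v != 0, coord_semilin v = v & v \notin <[u]>%VS]].
Proof.
move=> stabW dimW.
have [|u uW [u0 u_fix]] := exists_fixed_vector stabW; first by rewrite -dimv_eq0; lia.
have [i ui] := coord_neq0 u0; pose c : 'Hom(V, K^o) := linfun (coord e i : V -> K^o).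
have cE v : c v = coord e i v by rewrite lfunE.
pose W' := (W :&: lker c)%VS.
have [v vW||v] := @exists_fixed_vector W'.
- move: vW; rewrite !memv_cap !memv_ker !cE coord_semilinE => /andP[vW /eqP->].
  by rewrite rmorph0 eqxx stabW.
- have := limg_ker_dim c W; have := dimvS (subvf (c @: W)%VS); rewrite dimvf /= -dimv_eq0.
  by rewrite -/W' /dim /=; lia.
rewrite memv_cap memv_ker cE => /andP[vW /eqP vi] [v0 v_fix].
exists u, v; split=> //; split=> //; apply: contraNN v0 => /vlineP[k vk].
move: vi; rewrite vk linearZ /= => /eqP; rewrite mulf_eq0 (negPf ui) orbF => /eqP->.
by rewrite scale0r.
Qed.

Lemma coord_semilin_inj : injective coord_semilin.
Proof.
move=> u v uv; apply: coord_eqP => i; apply: (fmorph_inj tau).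
by rewrite -!coord_semilinE uv.
Qed.

Lemma coord_semilin_bij : bijective tau -> bijective coord_semilin.
Proof.
case=> f fK Kf; exists (fun v => \sum_i f (coord e i v) *: e`_i) => v.
  by apply: coord_eqP => i; rewrite coord_sum_basis coord_semilinE.
by apply: coord_eqP => i; rewrite coord_semilinE coord_sum_basis.
Qed.

(** Supplies the map on subspaces that [collineation] asks for when the Frobenius collineation has
    to be exhibited. *)
Definition semilin_image (W : {vspace V}) : {vspace V} :=
  (<<map coord_semilin (vbasis W)>>)%VS.

Lemma mem_semilin_image W v :
  bijective tau -> (coord_semilin v \in semilin_image W) = (v \in W).
Proof.
case=> tau' tauK tau'K; apply/idP/idP => [|vW].
  pose s := [tuple of map coord_semilin (vbasis W)].
  move=> /(@coord_span _ _ _ s) eq_v; set k := fun i => coord s i (coord_semilin v).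
  have -> : v = \sum_(i < \dim W) tau' (k i) *: (vbasis W)`_i.
    apply: coord_semilin_inj; rewrite eq_v linear_sum; apply: eq_bigr => i _.
    by rewrite linearZ /= tau'K (nth_map 0) ?size_tuple.
  by apply: memv_suml => i _; rewrite memvZ // vbasis_mem // mem_nth // size_tuple.
rewrite (coord_vbasis vW) linear_sum; apply: memv_suml => i _.
by rewrite linearZ memvZ // memv_span // map_f // mem_nth // size_tuple.
Qed.

End CoordinateSemilinear.

(** * Coordinates for a generator of the stabilizer *)

Section Subgeometry.
Variables (F : finFieldType) (K : fieldExtType F) (V : vectType K).

Lemma frob_bij : bijective (@frob F K).
Proof.
have fK x : iter (\dim {:K}) (@frob F K) x = x.
  rewrite iter_frob; have := Fermat's_little_theorem {:K}%AS x.
  by rewrite memvf => /esym/eqP.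
have K_gt0 : (0 < \dim {:K})%N by rewrite lt0n dimv_eq0 -subv0; apply/negP => /subvP/(_ 1 (memvf _)); rewrite memv0 oner_eq0.
exists (iter (\dim {:K}).-1 (@frob F K)) => x; last by rewrite -iterS prednK.
by rewrite -iterSr prednK.
Qed.

Lemma subspace_spanning_basis (S : {vspace restrict_scalars V}) :
  \dim S = \dim {:V} -> (<<(vbasis S : seq V)>> = fullv :> {vspace V})%VS ->
  exists e : (\dim S).-tuple V, basis_of fullv e /\
    forall u : V, u \in S <-> forall i, exists c : F, coord e i u = c%:A.
Proof.
move=> dimS spanS; pose e : (\dim S).-tuple V := vbasis S.
have e_basis : basis_of fullv e by rewrite basisEdim spanS subvv size_tuple dimS leqnn.
exists e; split=> // u; split=> [uS i|uF].
  exists (coord (vbasis S) i u); rewrite {1}(coord_vbasis uS) -[RHS](coord_sum_basis e_basis (fun i => (coord (vbasis S) i u)%:A)).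
  by congr (coord e i _); apply: eq_bigr.
have c i : {c : F | coord e i u == c%:A}.
  by apply: sigW; have [c ->] := uF i; exists c.
rewrite (coord_basis e_basis (memvf u)).
rewrite (_ : \sum_(i < _) _ = \sum_(i < \dim S) (sval (c i)) *: (vbasis S)`_i :> restrict_scalars V).
  by apply: memv_suml => i _; rewrite memvZ // vbasis_mem // mem_nth // size_tuple.
by apply: eq_bigr => i _; rewrite {1}(eqP (svalP (c i))).
Qed.

(** Fixing the points of Sigma forces [phi] to multiply all basis vectors by one scalar [lam] and
    [tau] to fix F, so [coord_semilin e tau] induces [sigma]. The Frobenius on coordinates also
    fixes Sigma pointwise, hence is a power of [sigma]. *)
Lemma subgeometry_stabilizer (Sigma : pointset V) (sigma : {vspace V} -> {vspace V}) :
  (1 < \dim {:V})%N -> canonical_subgeometry Sigma -> generates_stabilizer Sigma sigma ->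
  exists (S : {vspace restrict_scalars V}) (e : (\dim S).-tuple V) (tau : {rmorphism K -> K}),
  [/\ \dim S = \dim {:V}, basis_of fullv e, forall X, Sigma X <-> linear_set S X,
      forall u : V, u \in S <-> coord_semilin e tau u = u &
   [/\ forall W v, (coord_semilin e tau v \in sigma W) = (v \in W),
      forall c : F, tau c%:A = c%:A & exists k, forall x, iter k tau x = frob x]].
Proof.
move=> dimV [S [dimS spanS SigmaE]] [[[tau [phi [tau_bij phi_bij phiP]]] fix_sigma] gen].
have [e [e_basis memS]] := subspace_spanning_basis dimS spanS.
have m_gt1 : (1 < \dim S)%N by rewrite dimS.
have [i0 [i1 ne10]] : exists i0 i1 : 'I_(\dim S), i1 != i0.
  by exists (Ordinal (ltnW m_gt1)), (Ordinal m_gt1).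
have coord_e (i j : 'I_(\dim S)) : coord e j e`_i = (i == j)%:R by rewrite coord_free ?(basis_free e_basis).
have coordD_e (i : 'I_(\dim S)) (c : F) (j : 'I_(\dim S)) : coord e j (e`_i0 + c%:A *: e`_i) = (i0 == j)%:R + c%:A * (i == j)%:R.
  by rewrite linearD linearZ /= !coord_e.
have phiZ a v : phi (a *: v) = tau a *: phi v by exact: linearZ.
have fix_line (u : V) : u \in S -> u != 0 -> exists k : K, phi u = k *: u.
  move=> uS u0; apply/vlineP; rewrite -(fix_sigma <[u]>%VS).
    by rewrite phiP memv_line.
  by apply/SigmaE; exists u.
have nat_scalar (b : bool) (c : F) : exists d : F, c%:A * (b%:R : K) = d%:A.
  by case: b; [exists c; rewrite mulr1 | exists 0; rewrite mulr0 scale0r].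
have bool_scalar (b : bool) : exists d : F, (b%:R : K) = d%:A.
  by case: b; [exists 1; rewrite scale1r | exists 0; rewrite scale0r].
have eS (i : 'I_(\dim S)) : e`_i \in S.
  by apply/memS=> j; rewrite coord_e.
have e_neq0 (i : 'I_(\dim S)) : e`_i != 0.
  apply: contra_eq_neq (coord_e i i) => ->.
  by rewrite linear0 eqxx eq_sym oner_eq0.
have eDS (i : 'I_(\dim S)) (c : F) : e`_i0 + c%:A *: e`_i \in S.
  apply/memS=> j; rewrite coordD_e.
  have [d1 ->] := bool_scalar (i0 == j); have [d2 ->] := nat_scalar (i == j) c.
  by exists (d1 + d2); rewrite scalerDl.
have eD_neq0 (i : 'I_(\dim S)) (c : F) : i != i0 -> e`_i0 + c%:A *: e`_i != 0.
  move=> ne; apply: contra_eq_neq (coordD_e i c i0) => ->.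
  by rewrite linear0 eqxx (negPf ne) mulr0 addr0 eq_sym oner_eq0.
have [lam phi0] := fix_line _ (eS i0) (e_neq0 i0).
have phiE (i : 'I_(\dim S)) (c : F) : i != i0 -> phi e`_i = lam *: e`_i /\ (lam != 0 -> tau c%:A = c%:A).
  move=> ne; have [k phii] := fix_line _ (eS i) (e_neq0 i).
  (* Compares two coordinates of the image of the fixed point spanned by [e_i0 + d e_i]. The case d
     = 1 gives k = [lam], and then d = c gives the claim on [tau]. *)
  have main d : tau d%:A * k = lam * d%:A.
    have [mu phiD] := fix_line _ (eDS i d) (eD_neq0 i d ne).
    move: phiD; rewrite linearD phiZ phi0 phii => eq_v.
    have := congr1 (coord e i0) eq_v; have := congr1 (coord e i) eq_v.
    rewrite !linearD !linearZ /= !coord_e !eqxx (negPf ne) eq_sym (negPf ne).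
    by rewrite !(mulr0, addr0, add0r, mulr1) => -> ->.
  have k_lam : k = lam by have := main 1; rewrite scale1r rmorph1 mul1r mulr1.
  split=> [|lam0]; first by rewrite phii k_lam.
  by have := main c; rewrite k_lam mulrC => /(mulfI lam0).
have phi_e (i : 'I_(\dim S)) : phi e`_i = lam *: e`_i.
  by have [->//|ne] := eqVneq i i0; have [] := phiE i 0 ne.
have phi_csl v : phi v = lam *: coord_semilin e tau v.
  rewrite {1}(coord_basis e_basis (memvf v)) linear_sum scaler_sumr; apply: eq_bigr => i _.
  by rewrite phiZ phi_e !scalerA mulrC.
have lam0 : lam != 0.
  apply: contraNneq (e_neq0 i0) => lam0; rewrite -(inj_eq (bij_inj phi_bij)) linear0.
  by rewrite phi_csl lam0 scale0r.
have tauF (c : F) : tau c%:A = c%:A by have [] := phiE i1 c ne10 => _; apply.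
have sigmaP W v : (coord_semilin e tau v \in sigma W) = (v \in W).
  by rewrite -(phiP W v) phi_csl rpredZeq (negPf lam0).
pose g := semilin_image e (@frob F K).
have gP W v : (coord_semilin e (@frob F K) v \in g W) = (v \in W).
  by apply: mem_semilin_image => //; exact: frob_bij.
have csl_S (t : {rmorphism K -> K}) (u : V) : (forall c : F, t c%:A = c%:A) -> u \in S ->
    coord_semilin e t u = u.
  move=> tF /memS uS; apply: (coord_eqP e_basis) => i; rewrite coord_semilinE //.
  by have [c ->] := uS i; rewrite tF.
have [k gk] : exists k, g =1 iter k sigma.
  apply: gen; split.
    exists (@frob F K), (coord_semilin e (@frob F K)); split=> //; first exact: frob_bij.
    by apply: coord_semilin_bij => //; exact: frob_bij.
  move=> X /SigmaE[u [uS u0 ->]]; apply/esym/eqP; rewrite eqEdim -memvE.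
  rewrite -{1}(csl_S (@frob F K) u (@frob_scalar F K) uS) gP memv_line /=.
  rewrite dim_vline u0; apply: leq_trans (dim_span _) _.
  by rewrite size_map size_tuple dim_vline u0.
(* Both collineations are evaluated at the point of [e_i0 + x e_i1]: its coordinate 1 forces the
   proportionality factor [c] to be 1, and its coordinate x gives the identity. *)
have frob_tau x : iter k tau x = frob x.
  pose v := e`_i0 + x *: e`_i1.
  have [w vw] : exists w, coord_semilin e (@frob F K) v = iter k (coord_semilin e tau) w.
    move: (coord_semilin _ _ v) => z; elim: k {gk} z => [|k IHk] z; first by exists z.
    have [f _ fK] := coord_semilin_bij e_basis tau_bij.
    by have [w zw] := IHk (f z); exists w; rewrite /= -zw fK.
  have : coord_semilin e (@frob F K) v \in g <[v]>%VS by rewrite gP memv_line.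
  rewrite gk vw; have -> : forall j W u, (iter j (coord_semilin e tau) u \in iter j sigma W) = (u \in W).
    by elim=> //= j IHj W u; rewrite sigmaP.
  case/vlineP=> c wc; have cv i : frob (coord e i v) = iter k tau (c * coord e i v).
    by rewrite -coord_semilinE // vw coord_iter_semilin // wc linearZ.
  have v0 : coord e i0 v = 1 by rewrite linearD linearZ /= !coord_e eqxx (negPf ne10) mulr0 addr0.
  have v1 : coord e i1 v = x by rewrite linearD linearZ /= !coord_e eqxx eq_sym (negPf ne10) mulr1 add0r.
  have := cv i1; rewrite v1 => ->; congr (iter k tau _).
  have iter1 : iter k tau 1 = 1 by elim: k {gk vw cv} => //= k ->; rewrite rmorph1.
  have iter_inj : injective (iter k tau).
    by elim: k {gk vw cv iter1} => // k IHk y z /= /fmorph_inj/IHk.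
  suff -> : c = 1 by rewrite mul1r.
  by apply: iter_inj; rewrite iter1; have := cv i0; rewrite v0 mulr1 rmorph1 => <-.
exists S, e, tau; split=> // [u|]; last by split=> //; exists k.
split=> [uS|fix_u]; first exact: csl_S.
apply/memS=> i; apply: frob_fixed; rewrite -frob_tau.
have tau_i : tau (coord e i u) = coord e i u.
  by rewrite -coord_semilinE // fix_u.
by elim: k {gk frob_tau} => //= k ->.
Qed.

End Subgeometry.

(** * Linear sets and their projections *)

Lemma card_nonzero_vspace (F : finFieldType) (V : vectType F) (U : {vspace V}) :
  #|[set x : finvect_type V | (x \in U) && (x != 0)]| = (#|F| ^ \dim U).-1.
Proof.
case: V U => T cT U; have := @card_vspace F (finvect_type (Vector.Pack cT)) cT U.
rewrite (cardD1 0) mem0v => <-; rewrite add1n /=.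
by apply: eq_card => x; rewrite !inE andbC.
Qed.

(* Double count the pairs (u, w) with f u = g w: every u has at most #|F| - 1
   partners and every w has at least that many. *)
Lemma proportional_of_equal_image (F : finFieldType) (V1 V2 : vectType F) (P : eqType)
    (S : {vspace V1}) (U : {vspace V2}) (f : V1 -> P) (g : V2 -> P) :
  \dim S = \dim U ->
  (forall c u, c != 0 -> u \in S -> u != 0 -> f (c *: u) = f u) ->
  (forall u, u \in S -> u != 0 -> exists2 w, w \in U & w != 0 /\ g w = f u) ->
  (forall w, w \in U -> w != 0 -> exists2 u, u \in S & u != 0 /\ f u = g w) ->
  (forall w w', w \in U -> w != 0 -> w' \in U -> w' != 0 -> g w = g w' -> w' \in <[w]>%VS) ->
  forall u u', u \in S -> u != 0 -> u' \in S -> u' != 0 -> f u = f u' -> u' \in <[u]>%VS.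
Proof.
move=> dimSU fZ fg gf g_inj u u' uS u0 u'S u'0 fuu'; apply: contraT => u'u.
pose A := [set x : finvect_type V1 | (x \in S) && (x != 0)].
pose B := [set x : finvect_type V2 | (x \in U) && (x != 0)].
have cardAB : #|A| = #|B| by rewrite !card_nonzero_vspace dimSU.
pose q1 := #|F|.-1.
have count_w x : (#|[set y in B | g y == f x]| <= q1)%N.
  have [->|[w]] := set_0Vmem [set y in B | g y == f x]; first by rewrite cards0.
  rewrite !inE => /andP[/andP[wU w0] /eqP gw].
  rewrite -[q1](_ : (#|F| ^ \dim <[w]>%VS).-1 = _); last by rewrite dim_vline w0 expn1.
  rewrite -card_nonzero_vspace; apply/subset_leq_card/subsetP => y; rewrite !inE.
  move=> /andP[/andP[yU y0] /eqP gy]; rewrite y0 andbT.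
  by apply: g_inj => //; rewrite gw gy.
have line_sub v w : v \in S -> v != 0 -> f v = g w ->
    [set x : finvect_type V1 | (x \in <[v]>%VS) && (x != 0)] \subset [set x in A | f x == g w].
  move=> vS v0 fv; apply/subsetP => x; rewrite !inE => /andP[/vlineP[c ->] cv0].
  have c0 : c != 0 by apply: contraNneq cv0 => ->; rewrite scale0r.
  have cvS : c *: v \in S by apply: memvZ.
  have fcv : f (c *: v) = g w by rewrite fZ.
  by rewrite cv0 andbT; apply/andP; split; [exact: cvS | apply/eqP; exact: fcv].
have card_line (v : V1) : v != 0 ->
    #|[set x : finvect_type V1 | (x \in <[v]>%VS) && (x != 0)]| = q1.
  by move=> v0; rewrite card_nonzero_vspace dim_vline v0 expn1.
have count_u y : y \in B -> (q1 <= #|[set x in A | f x == g y]|)%N.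
  rewrite inE => /andP[yU y0]; have [v vS [v0 fv]] := gf y yU y0.
  by rewrite -(card_line v v0); apply/subset_leq_card/line_sub.
have [w wU [w0 gw]] := fg u uS u0.
have wB : (w : finvect_type V2) \in B by rewrite in_set wU.
(* The vector [u'] lies in this fibre outside [<[u]>], and this single excess unbalances the two
   counts. *)
have count_w0 : (q1 < #|[set x in A | f x == g w]|)%N.
  rewrite -(card_line u u0); apply: proper_card; apply/properP; split.
    by apply: line_sub.
  by exists u'; rewrite !inE ?u'S ?u'0 ?gw ?fuu' ?eqxx // (negPf u'u).
have exch : (\sum_(x in A) #|[set y in B | g y == f x]| =
             \sum_(y in B) #|[set x in A | f x == g y]|)%N.
  under eq_bigr => x _ do rewrite -sum1_card.
  under [RHS]eq_bigr => y _ do rewrite -sum1_card.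
  rewrite (exchange_big_dep (mem B)) /=; last by move=> x y _; rewrite inE => /andP[].
  apply: eq_bigr => y yB; apply: eq_bigl => x.
  by rewrite !inE (eq_sym (f x)); rewrite inE in yB; rewrite yB.
have : (\sum_(x in A) #|[set y in B | g y == f x]| <= #|A| * q1)%N.
  by rewrite -sum_nat_const; apply: leq_sum => x _; apply: count_w.
rewrite exch cardAB (bigD1 (w : finvect_type V2)) //= (cardD1 (w : finvect_type V2)) wB mulSn leqNgt.
suff : (#|[predD1 B & (w : finvect_type V2)]| * q1 <= \sum_(y in B | y != w) #|[set x in A | f x == g y]|)%N.
  by move=> le_sum /negP[]; rewrite -addSn leq_add.
rewrite -sum_nat_const (eq_bigl (fun y => (y \in B) && (y != w))); last first.
  by move=> y; rewrite !inE andbC.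
by apply: leq_sum => y /andP[yB _]; apply: count_u.
Qed.

(** * Transport along a linear isomorphism *)

Section Transfer.
Variables (F : finFieldType) (K : fieldExtType F) (V1 V2 : vectType K).
Variables (h : 'Hom(V1, V2)) (A : pointset V1) (B : pointset V2).
Hypotheses (h_inj : lker h == 0%VS) (h_surj : limg h = fullv).
Hypothesis ABh : forall Y, A Y <-> B (h @: Y)%VS.

Lemma lpreim_lker0 (X : {vspace V2}) : (h @: (h @^-1: X) = X)%VS.
Proof. by rewrite lpreimK // h_surj subvf. Qed.

Lemma mem_limg_lker0 (Y : {vspace V1}) v : (h v \in (h @: Y)%VS) = (v \in Y).
Proof. by rewrite !memvE -limg_line limg_ker0. Qed.

Lemma equivalent_limg : equivalent A B.
Proof.
exists (lfun_img h); split=> //.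
have hl : linear_for ((idfun : {rmorphism K -> K}) \; *:%R) h by move=> a u v; rewrite linearP.
pose hM := GRing.isLinear.Build K V1 V2 _ (h : V1 -> V2) hl.
pose hL : {linear V1 -> V2 | (idfun : {rmorphism K -> K}) \; *:%R} := HB.pack (h : V1 -> V2) hM.
exists idfun, hL; split=> [||W v]; last exact: mem_limg_lker0.
  by exists id.
exists h^-1%VF => v; first exact: lker0_lfunK.
by apply: limg_lfunVK; rewrite h_surj memvf.
Qed.

(** [h] is also F-linear and injective, so it preserves rank, and it maps the F-space under the
    preimage of a point onto the one under the point, so it preserves weights. *)
Lemma scattered_limg rho : scattered_linear_set rho A -> scattered_linear_set rho B.
Proof.
case=> U [dimU AU weightA].
have hF_lin : linear (h : restrict_scalars V1 -> restrict_scalars V2).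
  by move=> a u v; rewrite !rs_scaleE linearP.
pose hM := GRing.isLinear.Build F _ _ *:%R (h : restrict_scalars V1 -> restrict_scalars V2) hF_lin.
pose hF : 'Hom(restrict_scalars V1, restrict_scalars V2) :=
  linfun (HB.pack (h : restrict_scalars V1 -> restrict_scalars V2) hM
    : {linear restrict_scalars V1 -> restrict_scalars V2}).
have hFE v : hF v = h v by rewrite lfunE.
have hF_inj : lker hF == 0%VS.
  have hI : injective h by apply/lker0P.
  by apply/lker0P => u v; rewrite !hFE => /hI.
have dim_hF W : \dim (hF @: W) = \dim W.
  by apply: limg_dim_eq; rewrite (eqP hF_inj) capv0.
exists (hF @: U)%VS; split; first by rewrite dim_hF.
- move=> X; rewrite -{1}(lpreim_lker0 X) -ABh AU; split=> -[w [wU w0 XE]].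
    exists (h w); split; [by have := memv_img hF wU; rewrite hFE | |].
      by rewrite -memv_ker (eqP h_inj) memv0.
    by rewrite -limg_line -XE lpreim_lker0.
  have /memv_imgP[v vU wv] := wU; exists v; split=> //.
    by apply: contraNneq w0 => v0; rewrite wv v0 linear0.
  apply/eqP; rewrite -(eq_limg_ker0 _ _ h_inj) lpreim_lker0 XE limg_line.
  by rewrite wv hFE.
move=> X; rewrite -{1}(lpreim_lker0 X) -ABh => /weightA <-.
rewrite -dim_hF (lker0_img_cap _ _ hF_inj); congr (\dim (_ :&: _)%VS).
apply/vspaceP=> x; rewrite mem_rs_vspace; apply/idP/memv_imgP => [xX|[y]].
  have : x \in (h @: (h @^-1: X))%VS by rewrite lpreim_lker0.
  by case/memv_imgP => y yX xy; exists y; rewrite ?hFE // mem_rs_vspace.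
by rewrite mem_rs_vspace => yX ->; rewrite hFE memv_preim.
Qed.

End Transfer.

(** * Coordinates along a full orbit *)

Section OrbitCoordinates.
Variables (K : fieldType) (V : vectType K) (tau : {rmorphism K -> K}).
Variables (phi : {linear V -> V | tau \; *:%R}) (k : nat) (p : V).
Hypothesis dimV : \dim {:V} = k.+3.
Hypothesis iter_phi : forall v : V, iter k.+3 phi v = v.
Hypothesis iter_tau : forall x : K, iter k.+3 tau x = x.
Hypothesis orbit_full : orbit_span phi p k.+3 = fullv.

Let v : k.+3.-tuple V := [tuple iter i phi p | i < k.+3].

Let vE (i : 'I_k.+3) : v`_i = iter i phi p.
Proof. by rewrite -tnth_nth tnth_mktuple. Qed.

Let v_basis : basis_of fullv v.
Proof.
rewrite basisEdim size_tuple dimV leqnn andbT -orbit_full.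
by apply/orbit_span_sub => i ik; rewrite memv_span // -(vE (Ordinal ik)) mem_nth ?size_tuple.
Qed.

Let phiZ c u : phi (c *: u) = tau c *: phi u.
Proof. exact: linearZ. Qed.

Let coord_iter (i j : nat) : (i < k.+3)%N -> (j < k.+3)%N ->
  coord v (inord i) (iter j phi p) = (i == j)%:R.
Proof.
move=> ik jk; rewrite -[j](inordK jk) -vE coord_free ?(basis_free v_basis) //.
by rewrite eq_sym -val_eqE /= !inordK.
Qed.

Let phi_sum (c : nat -> K) :
  phi (\sum_(j < k.+3) c j *: iter j phi p) = \sum_(j < k.+3) tau (c j) *: iter j.+1 phi p.
Proof. by rewrite linear_sum; apply: eq_bigr => j _; apply: phiZ. Qed.

Let coord_sum (c : nat -> K) i : (i < k.+3)%N ->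
  coord v (inord i) (\sum_(j < k.+3) c j *: iter j phi p) = c i.
Proof.
move=> ik; rewrite (eq_bigr (fun j : 'I_k.+3 => c j *: v`_j)) => [|j _]; last by rewrite vE.
by rewrite (coord_sum_free (fun j => c j) _ (basis_free v_basis)) inordK.
Qed.

(** [phi] shifts the orbit basis by one place and applies [tau] to the coefficients; the last place
    wraps around to the first by [iter_phi]. *)
Lemma coord_fixed u i : phi u = u -> (i < k.+2)%N ->
  coord v (inord i.+1) u = tau (coord v (inord i) u).
Proof.
move=> phi_u ik.
have uE : u = \sum_(j < k.+3) coord v (inord j) u *: iter j phi p.
  rewrite {1}(coord_basis v_basis (memvf u)); apply: eq_bigr => j _.
  by rewrite vE inord_val.
pose z j := if j is j'.+1 then tau (coord v (inord j') u) else tau (coord v (inord k.+2) u).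
have uz : u = \sum_(j < k.+3) z j *: iter j phi p.
  rewrite -{1}phi_u {1}uE (phi_sum (fun j => coord v (inord j) u)).
  by rewrite big_ord_recr [RHS]big_ord_recl iter_phi [RHS]addrC.
by rewrite {1}uz coord_sum.
Qed.

Variables (G : {vspace V}) (a b : K).
Hypotheses (dimG : \dim G = k.+1) (subG : (orbit_span phi p k <= G)%VS).
Hypotheses (b0 : b != 0) (wG : a *: iter k phi p + b *: iter k.+2 phi p \in G).
Let delta := - (a / b).

(** [delta] is chosen to make the second form vanish on the vector of [wG], where its value is delta
    b + a. *)
Let P0 (u : V) : (K^o * K^o)%type :=
  (coord v (inord k.+1) u, delta * coord v (inord k.+2) u + coord v (inord k) u).

Fact orbit_projection_is_linear : linear P0.
Proof.
move=> c u w; rewrite /P0 !linearP; congr (_, _) => /=.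
by rewrite mulrDr scalerDr mulrCA !addrA; congr (_ + _); rewrite -!addrA; congr (_ + _); rewrite addrC.
Qed.

Lemma exists_LP_projection : exists P : 'Hom(V, (K^o * K^o)%type),
  [/\ lker P = G,
      forall u, phi u = u -> exists x, P u = (x, delta * tau x + iter k.+2 tau x)
    & forall x, exists2 u, phi u = u & P u = (x, delta * tau x + iter k.+2 tau x)].
Proof.
pose PM := GRing.isLinear.Build K V (K^o * K^o)%type *:%R P0 orbit_projection_is_linear.
pose P : 'Hom(V, (K^o * K^o)%type) := linfun (HB.pack P0 PM : {linear V -> (K^o * K^o)%type}).
have PE u : P u = P0 u by rewrite lfunE.
have P_fixed u : phi u = u ->
    P u = (coord v (inord k.+1) u, delta * tau (coord v (inord k.+1) u)
             + iter k.+2 tau (coord v (inord k.+1) u)).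
  move=> phi_u; rewrite PE /P0 (coord_fixed phi_u (ltnSn k.+1)); congr (_, _ + _).
  (* [iter k.+2 tau] is the inverse of [tau], so it recovers the coordinate of index k from that of
     index k + 1. *)
  by rewrite (coord_fixed phi_u (ltnW (ltnSn k.+1))) -iterSr iter_tau.
exists P; split=> [|u phi_u|x]; last first.
(* The two extra applications of [tau] make the coordinate of index k + 1 equal to
   [iter k.+3 tau x], that is x. *)
- pose c j := iter j tau (iter 2 tau x).
  pose u := \sum_(j < k.+3) c j *: iter j phi p.
  have phi_u : phi u = u.
    rewrite /u phi_sum big_ord_recr [RHS]big_ord_recl iter_phi [RHS]addrC.
    by congr (_ + _ *: _); apply: iter_tau.
  have xE : coord v (inord k.+1) u = x.
    by rewrite coord_sum // /c -iterD addn2 iter_tau.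
  by exists u => //; rewrite P_fixed // xE.
- by eexists; apply: P_fixed.
(* Subtracting a multiple of [w] cancels the last coordinate; the kernel equations then leave only
   the first k orbit vectors, which lie in [G]. Equality follows because the target has dimension
   2. *)
have kerG : (lker P <= G)%VS.
  apply/subvP => u; rewrite memv_ker PE => /eqP[u1 u02].
  pose w := a *: iter k phi p + b *: iter k.+2 phi p.
  pose y := u - (coord v (inord k.+2) u / b) *: w.
  suff yG : y \in G by rewrite -[u](subrK ((coord v (inord k.+2) u / b) *: w)) memvD ?memvZ.
  have cw i : (i < k.+3)%N -> coord v (inord i) w = a * (i == k)%:R + b * (i == k.+2)%:R.
    by move=> ik; rewrite linearD !linearZ; congr (a * _ + b * _); apply: coord_iter; lia.
  have cy i : (i < k.+3)%N -> coord v (inord i) y = coord v (inord i) u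
      - (coord v (inord k.+2) u / b) * (a * (i == k)%:R + b * (i == k.+2)%:R).
    by move=> ik; rewrite linearB linearZ /= cw.
  rewrite (coord_basis v_basis (memvf y)); apply: memv_suml => i _; rewrite vE.
  have [ik|ki] := ltnP i k; first by rewrite memvZ // (subvP subG) // mem_orbit_span.
  suff -> : coord v i y = 0 by rewrite scale0r mem0v.
  rewrite -(inord_val i) cy ?ltn_ord //.
  have : (i == k :> nat) || (i == k.+1 :> nat) || (i == k.+2 :> nat).
    by have := ltn_ord i; lia.
  case/orP=> [/orP[]|] /eqP ->.
  - rewrite eqxx (_ : (k == k.+2) = false) ?mulr1 ?mulr0 ?addr0; last lia.
    move: u02; rewrite /delta => /eqP; rewrite addrC addr_eq0 => /eqP->.
    by rewrite mulNr opprK; apply/eqP; rewrite subr_eq0; apply/eqP; field.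
  - by rewrite u1 (_ : (k.+1 == k) = false) 1?(_ : (k.+1 == k.+2) = false) ?mulr0 ?addr0 ?mulr0 ?subr0 //; lia.
  - rewrite eqxx (_ : (k.+2 == k) = false) ?mulr0 ?add0r ?mulr1; last lia.
    by rewrite divfK // subrr.
apply/eqP; rewrite eqEdim kerG dimG.
have := limg_ker_dim P fullv; rewrite capfv dimV.
have : (\dim (limg P) <= 2)%N by rewrite (leq_trans (dimvS (subvf _))) // dimvf.
lia.
Qed.

End OrbitCoordinates.

(** * Injectivity of a scattered projection *)

Section Projection.
Variables (F : finFieldType) (K : fieldExtType F) (V : vectType K).
Variables (Gamma Lambda : {vspace V}) (Sigma : pointset V).

Lemma subvs_section (W : {vspace V}) : (W <= Lambda)%VS ->
  exists Y, (linfun (vsval : subvs_of Lambda -> V) @: Y)%VS = W.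
Proof.
move=> WL; exists (linfun (vsval : subvs_of Lambda -> V) @^-1: W)%VS.
apply: lpreimK; apply/subvP => x xW; apply/memv_imgP.
by exists (vsproj Lambda x); rewrite ?memvf // lfunE /= vsprojK // (subvP WL).
Qed.

Lemma vsval_lfun_inj : lker (linfun (vsval : subvs_of Lambda -> V)) == 0%VS.
Proof. by apply/lker0P => u w; rewrite !lfunE; apply: val_inj. Qed.

Lemma line_scaler (c : K) (u : V) : c != 0 -> <[c *: u]>%VS = <[u]>%VS.
Proof.
move=> c0; apply/eqP; rewrite eqEsubv -!memvE memvZ ?memv_line //=.
by rewrite -{1}[u](scalerK c0) memvZ // memv_line.
Qed.

(** Scatteredness only supplies some [U] defining the projected point set, with no given link to
    [S]. Since [U] and [S] have the same rank, [proportional_of_equal_image] carries injectivity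
    over by counting. *)
Lemma scattered_projection_inj (S : {vspace restrict_scalars V}) :
  (forall X, Sigma X <-> linear_set S X) ->
  scattered_linear_set (\dim S) (projection Gamma Lambda Sigma) ->
  forall u u' : V, u \in S -> u != 0 -> u' \in S -> u' != 0 ->
    (Gamma + <[u]> = Gamma + <[u']>)%VS -> u' \in <[u]>%VS.
Proof.
move=> SigmaE [U [dimU AU weightU]] u u' uS u0 u'S u'0 uu'.
set i := linfun (vsval : subvs_of Lambda -> V) in AU weightU *.
pose f (u : restrict_scalars V) := ((Gamma + <[u : V]>) :&: Lambda)%VS.
pose g (w : restrict_scalars (subvs_of Lambda)) := (i @: <[w : subvs_of Lambda]>)%VS.
have i_inj := vsval_lfun_inj.
suff : u' \in (<[u : restrict_scalars V]>)%VS.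
  by case/vlineP => c ->; apply/vlineP; exists c%:A.
apply: (@proportional_of_equal_image F _ _ _ S U f g) => //.
- move=> c x c0 xS x0; rewrite /f [c *: x]rs_scaleE line_scaler //.
  by rewrite scaler_eq0 oner_eq0 orbF.
- move=> x xS x0; have [Y YE] := subvs_section (capvSr (Gamma + <[x : V]>)%VS Lambda).
  have /AU[w [wU w0 Yw]] : projection Gamma Lambda Sigma Y.
    by exists <[x : V]>%VS => //; apply/SigmaE; exists x.
  by exists w => //; split=> //; rewrite /g -Yw YE.
- move=> w wU w0; have [X /SigmaE[x [xS x0 ->]] wX] :
    projection Gamma Lambda Sigma <[w : subvs_of Lambda]>%VS by apply/AU; exists w.
  by exists x.
- move=> w w' wU w0 w'U w'0 /eqP; rewrite eq_limg_ker0 // => /eqP ww'.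
  have /weightU dim1 : projection Gamma Lambda Sigma <[w : subvs_of Lambda]>%VS.
    by apply/AU; exists w.
  set W := (_ :&: _)%VS in dim1.
  have lineW x : x \in U -> x \in <[w : subvs_of Lambda]>%VS -> x \in W.
    by move=> xU xw; rewrite memv_cap xU /= mem_rs_vspace.
  have /eqP -> : <[w]>%VS == W.
    by rewrite eqEdim dim1 dim_vline w0 -memvE (lineW w wU (memv_line _)).
  by apply: lineW => //; rewrite ww'; apply: memv_line.
by rewrite /f uu'.
Qed.

End Projection.

Section OrbitSpanned.
Variables (F : finFieldType) (K : fieldExtType F) (V : vectType K) (tau : {rmorphism K -> K}).
Variables (phi : {linear V -> V | tau \; *:%R}) (sigma : {vspace V} -> {vspace V}).
Variable n : nat.
Hypothesis n_ge4 : (4 <= n)%N.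
Hypothesis sigmaP : forall (W : {vspace V}) (v : V), (phi v \in sigma W) = (v \in W).
Hypothesis iter_phi_n : forall v : V, iter n phi v = v.
Variable Gamma : {vspace V}.

Let n_gt0 : (0 < n)%N. Proof. exact: leq_trans n_ge4. Qed.

Lemma is_pointP (X : {vspace V}) : is_point X <-> exists2 p, p != 0 & X = <[p]>%VS.
Proof.
rewrite /is_point /pdim; split=> [X1|[p p0 ->]]; last by rewrite dim_vline p0.
have dimX : \dim X = 1 by lia.
have X0 : vpick X != 0 by rewrite vpick0 -dimv_eq0 dimX.
by exists (vpick X) => //; apply/esym/eqP; rewrite eqEdim -memvE memv_pick dimX dim_vline X0.
Qed.

Lemma orbit_sum p : (\sum_(i < n - 3) iter i sigma <[p]> = orbit_span phi p (n - 3))%VS.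
Proof. by apply: eq_bigr => i _; rewrite (iter_sigma_line n_gt0 sigmaP iter_phi_n). Qed.

(** By [no_invariant] the orbit span has dimension n - 3, so its complement in [Gamma] is a point
    and serves as [Q]. *)
Lemma spanned_by_orbitP P : no_invariant sigma Gamma -> \dim Gamma = (n - 2)%N ->
  spanned_by_orbit n sigma Gamma P <->
  exists p, [/\ p != 0, P = <[p]>%VS & (orbit_span phi p (n - 3) <= Gamma)%VS].
Proof.
move=> noinv dimG; split=> [[/is_pointP[p p0 ->]] [Q _ ->]|[p [p0 -> sub]]].
  by exists p; split=> //; rewrite -orbit_sum addvSl.
split; first by apply/is_pointP; exists p.
have dimG' : \dim Gamma = (n - 3).+1 by lia.
have [Q dimQ GQ] := orbit_span_complement n_gt0 sigmaP iter_phi_n noinv p0 sub dimG'.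
by exists Q; [rewrite /is_point /pdim dimQ | rewrite orbit_sum].
Qed.

End OrbitSpanned.

(** The first bound is the failure of the condition at r = 1, the second its validity at r = 2. For
    n = 4 the difference n - 5 is truncated to 0. *)
Lemma intn_eq2_dim (F : finFieldType) (K : fieldExtType F) (V : vectType K) (n : nat)
    (sigma : {vspace V} -> {vspace V}) (Gamma : {vspace V}) :
  (4 <= n)%N -> pdim Gamma = n%:Z - 3 -> intn sigma Gamma = 2 ->
  (\dim (Gamma :&: sigma Gamma) < n - 3)%N /\
  (n - 5 <= \dim (Gamma :&: sigma Gamma :&: sigma (sigma Gamma)))%N.
Proof.
rewrite /intn; case: ex_minnP => r cond_r min_r n4 dimG r2; subst r.
have : ~~ intn_cond sigma Gamma 1 by apply/negP => /min_r.
move: cond_r; rewrite /intn_cond dimG /pdim !big_ord_recr !big_ord0 /= !capfv.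
by lia.
Qed.

(** The degree is n + 1 here, so [iter n tau] is the inverse of [tau], namely the power map of
    exponent q^(n+1-s). *)
Lemma LP_setE (F : finFieldType) (K : fieldExtType F) (s : nat) (delta : K)
    (tau : {rmorphism K -> K}) (n : nat) (X : {vspace (K^o * K^o)%type}) :
  n.+1 = \dim {:K} -> (forall x, tau x = x ^+ (#|F| ^ s)) -> (s <= n.+1)%N ->
  (forall x, iter n.+1 tau x = x) ->
  LP_set s delta X <->
  exists2 x, x != 0 & X = <[(x, delta * tau x + iter n tau x)%R : K^o * K^o]>%VS.
Proof.
move=> dimK tauE s_n tau_n; rewrite /LP_set -dimK.
have tau_inv x : iter n tau x = x ^+ (#|F| ^ (n.+1 - s)).
  apply: (fmorph_inj tau); rewrite -iterS tau_n tauE -exprM -expnD subnK //.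
  by rewrite -iter_frob dimK iter_frob; have := Fermat's_little_theorem {:K}%AS x; rewrite memvf => /esym/eqP.
by split=> -[x x0 ->]; exists x; rewrite ?tauE ?tau_inv.
Qed.

(** [P] kills Gamma, so a point X and its projection have the same image, and [P] restricts to an
    isomorphism on Lambda, a complement of its kernel. Transport along it also proves that the LP
    set is maximum scattered. *)
Lemma LP_type_of_projection (F : finFieldType) (K : fieldExtType F) (V : vectType K) 
    (Gamma Lambda : {vspace V}) (Sigma : pointset V)
    (S : {vspace restrict_scalars V}) (P : 'Hom(V, (K^o * K^o)%type)) (s : nat) (delta : K) :
  (forall X, Sigma X <-> linear_set S X) -> \dim Lambda = 2 ->
  (Gamma :&: Lambda = 0)%VS -> (Gamma + Lambda)%VS = fullv -> lker P = Gamma ->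
  (forall X, LP_set s delta X <-> exists u : V, [/\ u \in S, u != 0 & X = <[P u]>%VS]) ->
  (0 < s < \dim {:K})%N -> coprime s (\dim {:K}) -> delta != 0 ->
  scattered_linear_set (\dim {:K}) (projection Gamma Lambda Sigma) ->
  LP_type (projection Gamma Lambda Sigma).
Proof.
move=> SigmaE dimL GL0 GLV kerP LPE s_n s_cop delta0 scat.
pose i := linfun (vsval : subvs_of Lambda -> V).
pose h : 'Hom(subvs_of Lambda, (K^o * K^o)%type) := (P \o i)%VF.
have iL w : i w \in Lambda by rewrite lfunE /= subvsP.
have h_inj : lker h == 0%VS.
  rewrite -subv0; apply/subvP => w; rewrite memv_ker comp_lfunE -memv_ker kerP => wG.
  have : i w \in (Gamma :&: Lambda)%VS by rewrite memv_cap wG iL.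
  by rewrite GL0 !memv0 lfunE.
have h_surj : limg h = fullv.
  apply/eqP; rewrite eqEdim subvf limg_dim_eq ?(eqP h_inj) ?capv0 //.
  by rewrite !dimvf [in X in (_ <= X)%N]/dim /= dimL.
have imgP X : (P @: ((Gamma + X) :&: Lambda) = P @: X)%VS.
  have PG : (P @: Gamma = 0)%VS by apply/eqP; rewrite -lkerE kerP.
  apply/eqP; rewrite eqEsubv; apply/andP; split.
    by apply: subv_trans (limgS _ (capvSl _ _)) _; rewrite limgD PG add0v.
  apply/subvP => _ /memv_imgP[x xX ->].
  have /memv_addP[c cG [l lL xE]] : x \in (Gamma + Lambda)%VS by rewrite GLV memvf.
  have -> : P x = P l.
    by rewrite xE linearD /=; move: cG; rewrite -kerP memv_ker => /eqP->; rewrite add0r.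
  rewrite memv_img // memv_cap lL andbT (_ : l = - c + x); last by rewrite xE addKr.
  by rewrite memv_add ?memvN.
have ALP Y : projection Gamma Lambda Sigma Y <-> LP_set s delta (h @: Y)%VS.
  rewrite LPE limg_comp; split=> [[X /SigmaE[u [uS u0 ->]] ->]|[u [uS u0 PY]]].
    by exists u; rewrite imgP limg_line.
  exists <[u]>%VS; first by apply/SigmaE; exists u.
  have [Y' Y'E] := subvs_section (capvSr (Gamma + <[u]>)%VS Lambda).
  rewrite -Y'E; congr (_ @: _)%VS; apply/eqP; rewrite -(eq_limg_ker0 _ _ h_inj).
  by rewrite !limg_comp PY Y'E imgP limg_line.
exists s, delta; split=> //; first exact: scattered_limg h_inj h_surj ALP _ scat.
exact: equivalent_limg h_inj h_surj ALP.
Qed.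

(** * Subspaces with intersection number two *)

Theorem theorem3p1 (F : finFieldType) (K : fieldExtType F) (n : nat)
    (hn : (4 <= n)%N) (hK : \dim {:K} = n)
    (V : vectType K) (hV : \dim {:V} = n)
    (Gamma Lambda : {vspace V}) (Sigma : pointset V)
    (hGamma : pdim Gamma = n%:Z - 3) (hLambda : pdim Lambda = 1)
    (hSigma : canonical_subgeometry Sigma)
    (hGS : forall X, Sigma X -> ~~ (X <= Gamma)%VS)
    (hGL : (Gamma :&: Lambda = 0)%VS)
    (hL : scattered_linear_set n (projection Gamma Lambda Sigma))
    (sigma : {vspace V} -> {vspace V})
    (hsigma : generates_stabilizer Sigma sigma)
    (hintn : intn sigma Gamma = 2%N) :
  (exists P, spanned_by_orbit n sigma Gamma P /\
     ((5 <= n)%N -> forall P', spanned_by_orbit n sigma Gamma P' -> P' = P)) /\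
  (forall P, spanned_by_orbit n sigma Gamma P ->
     ((iter (n - 1) sigma P + iter (n - 3) sigma P) :&: Gamma)%VS <> 0%VS ->
     LP_type (projection Gamma Lambda Sigma)).
Proof.
have dimG : \dim Gamma = (n - 2)%N by move: hGamma; rewrite /pdim; lia.
have dimL : \dim Lambda = 2 by move: hLambda; rewrite /pdim; lia.
have n_gt0 : (0 < n)%N by lia.
have dimV_gt1 : (1 < \dim {:V})%N by lia.
have dimK_gt1 : (1 < \dim {:K})%N by lia.
have [S [e [tau [dimS e_basis SigmaE memS [sigmaP tauF [k tauk]]]]]] :=
  subgeometry_stabilizer dimV_gt1 hSigma hsigma.
have [tau_n [s [s_n s_cop tauE]]] := frob_generator tauF tauk dimK_gt1.
pose phi : {linear V -> V | tau \; *:%R} := coord_semilin e tau.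
rewrite hK in tau_n.
have iter_phi v : iter n phi v = v.
  by apply: (coord_eqP e_basis) => i; rewrite (coord_iter_semilin _ e_basis) tau_n.
have stab W : (sigma W <= W)%VS -> {in W, forall v, phi v \in W}.
  by move=> /subvP sW v vW; apply: sW; rewrite sigmaP.
have noinv : no_invariant sigma Gamma.
  move=> W WG sW; apply/eqP; apply: contraT => W0.
  have [u uW [u0 phi_u]] := exists_fixed_vector e_basis (stab W sW) W0.
  have /hGS : Sigma <[u]>%VS by apply/SigmaE; exists u; split=> //; apply/memS.
  by rewrite -memvE (subvP WG).
have [dimU1 dimU2] := intn_eq2_dim hn hGamma hintn.
have orbP P := spanned_by_orbitP hn sigmaP iter_phi P noinv dimG.
split.
  have [n4|n5] := leqP n 4.
    (* For n = 4 the orbit part is the single point P, and any point of Gamma will do. *)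
    have n_eq4 : n = 4 by lia.
    exists <[vpick Gamma]>%VS; split; last by lia.
    apply/orbP; exists (vpick Gamma); split=> //.
      by rewrite vpick0 -dimv_eq0; lia.
    by rewrite n_eq4 /orbit_span big_ord1 -memvE memv_pick.
  pose m := (n - 5)%N; have n_m : n = m.+4.+1 by lia.
  have [p [p0 pG] p_uniq] : exists2 p, p != 0 /\ (orbit_span phi p m.+2 <= Gamma)%VS
      & forall p', p' != 0 -> (orbit_span phi p' m.+2 <= Gamma)%VS -> <[p']>%VS = <[p]>%VS.
    apply: (exists_orbit_point n_gt0 sigmaP iter_phi noinv); rewrite ?hV ?dimG //; try lia.
    by rewrite (sigma_cap n_gt0 sigmaP iter_phi) capvA -(capvA Gamma) capvv; lia.
  have n3 : (n - 3 = m.+2)%N by lia.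
  exists <[p]>%VS; split; first by apply/orbP; exists p; rewrite n3.
  by move=> _ P' /orbP[p' [p'0 -> p'G]]; apply: p_uniq; rewrite -?n3.
move=> P /orbP[p [p0 -> pG]].
rewrite !(iter_sigma_line n_gt0 sigmaP iter_phi) => /eqP cap0.
have [a [b [ab0 wG]]] : exists a b, (a, b) != (0, 0) /\
    a *: iter (n - 3) phi p + b *: iter (n - 1) phi p \in Gamma.
  set C := (_ :&: _)%VS in cap0; have := memv_pick C; rewrite -vpick0 in cap0.
  rewrite memv_cap => /andP[/memv_addP[_ /vlineP[b ->] [_ /vlineP[a ->] wE]] wG].
  exists a, b; rewrite addrC -wE; split=> //; apply: contraNneq cap0 => -[a0 b0].
  by rewrite wE a0 b0 !scale0r addr0.
(* Gamma has dimension n - 2, so joining it to any fixed vector of [M] already gives M + Gamma; two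
   independent fixed vectors would yield distinct points of Sigma with one projection. *)
have scat M : (sigma M <= M)%VS -> (\dim (M + Gamma) < n)%N -> (\dim M <= 1)%N.
  move=> sM ltMG; rewrite leqNgt; apply/negP => dimM.
  have [u [v [uM u0 phi_u [vM v0 phi_v v_u]]]] := exists_two_fixed_vectors e_basis (stab M sM) dimM.
  have spanMG x : x \in M -> x != 0 -> phi x = x -> (Gamma + <[x]> = M + Gamma)%VS.
    move=> xM x0 phi_x; have xS : x \in S by apply/memS.
    have /hGS xG : Sigma <[x]>%VS by apply/SigmaE; exists x.
    apply/eqP; rewrite eqEdim subv_add addvSr /= -memvE (subvP (addvSl M Gamma)) //=.
    have : (\dim Gamma < \dim (Gamma + <[x]>))%N.
      rewrite ltnNge; apply: contraNN xG => le.
      by apply/addv_idPl/esym/eqP; rewrite eqEdim addvSl le.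
    by move: ltMG; rewrite dimG; clear; lia.
  case/negP: v_u; apply: (scattered_projection_inj SigmaE _ _ u0 _ v0).
  - by rewrite dimS hV; exact: hL.
  - by apply/memS.
  - by apply/memS.
  - by rewrite !spanMG.
have [a0 b0 full] := orbit_span_full n_gt0 sigmaP iter_phi hn hV dimG noinv scat dimU1 p0 pG wG ab0.
have [m n_m] : exists m, n = m.+3 by exists (n - 3)%N; move: hn; clear; lia.
have n_m3 : (n - 3)%N = m by rewrite n_m !subSS subn0.
have n_m1 : (n - 1)%N = m.+2 by rewrite n_m !subSS subn0.
have dimG' : \dim Gamma = m.+1 by rewrite dimG n_m !subSS subn0.
rewrite n_m3 n_m1 in wG; rewrite n_m3 in pG; rewrite n_m in full iter_phi tau_n hV.
have [pr [ker_pr pr_fixed pr_surj]] := exists_LP_projection hV iter_phi tau_n full dimG' pG b0 wG.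
set delta := - (a / b) in pr_fixed pr_surj.
have dimK : m.+3 = \dim {:K} by rewrite hK.
rewrite -{1}hK in hL.
apply: (@LP_type_of_projection F K V Gamma Lambda Sigma S pr s delta) => //.
- by apply/eqP; rewrite eqEdim subvf /= dimv_disjoint_sum // dimG' dimL hV addn2 leqnn.
- move=> X; rewrite (LP_setE _ _ dimK tauE) //; last by case/andP: s_n => _ /ltnW; rewrite -dimK.
  split=> [[x x0 ->]|[u [uS u0 ->]]].
    have [u phi_u pr_u] := pr_surj x; exists u; split; [exact/memS | | by rewrite pr_u].
    by apply: contraNneq x0 => u0; move: pr_u; rewrite u0 linear0 => -[<-].
  have [x pr_u] := pr_fixed u (proj1 (memS u) uS); exists x; last by rewrite pr_u.
  (* x = 0 would put [u] in the kernel Gamma, against its disjointness from Sigma. *)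
  have /hGS uG : Sigma <[u]>%VS by apply/SigmaE; exists u.
  apply: contraNneq uG => x0; rewrite -memvE -ker_pr memv_ker pr_u x0.
  by have -> : iter m.+2 tau 0 = 0; [elim: m.+2 => //= j ->; rewrite rmorph0 | rewrite rmorph0 mulr0 addr0].
by rewrite oppr_eq0 mulf_neq0 ?invr_eq0.
Qed.
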